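(* Let $0<\kappa\le\frac12$ and $p>1$. Each of the following functions $S:[0,+\infty)\to\mathbb R$, $$S_{\rm exp}(r)=1-e^{-\kappa r},\qquad S_{\rm alg}(r)=\frac{\kappa r}{\sqrt{1+\kappa^2r^2}},\qquad S_{\rm poly}(r)=1-\left(1+\frac{\kappa r}{p}\right)^{-p},\qquad r\ge0,$$ satisfies $$0<2S'(r)+S(r)^2\le1\qquad\text{for all }r\ge0$$ and $$S'(0)=\kappa,\qquad S(r)\to1,\ \ S'(r)\to0\ \text{ as }r\to+\infty,\qquad\int_0^{+\infty}\bigl(1-S(r)\bigr)\,dr<+\infty .$$ Consequently, for each of these choices, with $\mu>0$, $\theta(t)=\frac1{\sqrt\mu}S(\sqrt\mu\,t)$ and $\gamma=1+\frac1\kappa\ge3$, the damping coefficient $\delta_\mu(t)=\frac{1+\dot\theta(t)}{\theta(t)}+\mu\theta(t)$ satisfies $$\delta_\mu(t)\to\frac\gamma t\ \text{ as }\mu\downarrow0\ (\text{for every fixed }t>0),\qquad\delta_\mu(t)\to2\sqrt\mu\ \text{ as }t\to+\infty\ (\text{for every fixed }\mu>0),$$ and, for every $t_0>0$, every real Hilbert space $\mathcal H$ and every continuously Fréchet differentiable, $\mu$-strongly convex $\Phi:\mathcal H\to\mathbb R$ with $\operatorname{argmin}\Phi\ne\varnothing$ and $\Phi^*=\min\Phi$, every global solution $x\in C^2([t_0,+\infty),\mathcal H)$ of $$\ddot x(t)+\delta_\mu(t)\dot x(t)+\nabla\Phi(x(t))=0,\qquad t\ge t_0,$$ satisfies $$\Phi(x(t))-\Phi^*=\mathcal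 O\left(\min\left\{\frac1{t^2},e^{-\sqrt\mu t}\right\}\right).$$
   Context: A differentiable function $\Phi$ on $\mathcal H$ is $\mu$-strongly convex if $\Phi(y)\ge\Phi(x)+\langle\nabla\Phi(x),y-x\rangle+\frac{\mu}{2}\|y-x\|^2$ for all $x,y\in\mathcal H$. The $\mathcal O$ is over $t\ge t_0$, with a constant that may depend on $\mu$, $t_0$, $S$, $\Phi$ and the solution $x$. *)

(* Defs.v *)
From HB Require Import structures.
From mathcomp Require Import all_boot all_order all_algebra.
From mathcomp Require Import sesquilinear.
From mathcomp Require Import all_classical all_reals all_analysis.

Set Implicit Arguments.
Unset Strict Implicit.
Unset Printing Implicit Defensive.
Import Order.TTheory GRing.Theory Num.Theory.
Import numFieldNormedType.Exports.
Local Open Scope classical_set_scope.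
Local Open Scope ring_scope.

(* Difference quotients of [f] at [t] along the increments [h != 0], [h -> 0],
   with [t + h] in [[a, +oo[]. This is the one-sided quotient at [t = a] and
   the two-sided one at [t > a], and it never uses [f] to the left of [a]. *)
Definition quotient_from (R : realType) (V : normedModType R)
    (a : R) (f : R -> V) (t : R) : set_system V :=
  h^-1 *: (f (t + h) - f t) @[h --> within [set h | a <= t + h] 0^'].

Definition derivable_from (R : realType) (V : normedModType R)
    (a : R) (f : R -> V) (t : R) : Prop :=
  cvg (quotient_from a f t).

Definition derive_from (R : realType) (V : normedModType R)
    (a : R) (f : R -> V) (t : R) : V :=
  lim (quotient_from a f t).

Lemma derive_from_interior (R : realType) (V : normedModType R)
    (a : R) (f : R -> V) (t : R) :
  a < t -> derive_from a f t = derive1 f t.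
Proof.
move=> at_; rewrite /derive_from /quotient_from /derive1.
have -> : within [set h | a <= t + h] (0:R)^' = (0:R)^'.
  apply/seteqP; split => A; rewrite /within /=.
    move=> H; have G : \forall h \near (0:R)^', a <= t + h.
      near=> h; have : `|h| < t - a.
        by near: h; apply: dnbhs0_lt; rewrite subr_gt0.
      by rewrite ltr_norml opprB => /andP[h1 _]; rewrite addrC -lerBlDr ltW.
    by move: H G; apply: filterS2 => h; exact.
  by move=> H; move: (H); apply: filterS => h ? ?.
suff -> : (fun h => h^-1 *: (f (t + h) - f t)) =
          (fun h => h^-1 *: (f (h + t) - f t)) by [].
by apply/funext => h; rewrite (addrC t).
Unshelve. all: by end_near. Qed.

Definition C2_from (R : realType) (V : normedModType R)
    (a : R) (f : R -> V) : Prop :=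
  [/\ forall t, a <= t -> derivable_from a f t,
      forall t, a <= t -> derivable_from a (derive_from a f) t &
      {within `[a, +oo[, continuous (derive_from a (derive_from a f))}].

(* The three profiles are meant on [[0, +oo[]; their values to the left of 0 are
   never used below. *)
Definition S_exp (R : realType) (kappa r : R) : R := 1 - expR (- (kappa * r)).

Definition S_alg (R : realType) (kappa r : R) : R :=
  kappa * r / Num.sqrt (1 + kappa ^+ 2 * r ^+ 2).

Definition S_poly (R : realType) (kappa p r : R) : R :=
  1 - (1 + kappa * r / p) `^ (- p).

Definition theta (R : realType) (S : R -> R) (mu t : R) : R :=
  (Num.sqrt mu)^-1 * S (Num.sqrt mu * t).

Definition delta (R : realType) (S : R -> R) (mu t : R) : R :=
  (1 + derive_from 0 (theta S mu) t) / theta S mu t + mu * theta S mu t.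

(* A complete normed module whose norm satisfies this for a positive definite
   symmetric form [ip] is a real Hilbert space with inner product [ip]. *)
Definition induces_norm (R : realType) (H : normedModType R)
    (ip : {dot H for @idfun R}) : Prop :=
  forall u, `|u| ^+ 2 = ip u u.

(* Frechet differentiability, with the differential continuous for the
   operator norm. *)
Definition C1_frechet (R : realType) (H : normedModType R) (Phi : H -> R) : Prop :=
  (forall x, differentiable Phi x) /\
  (forall x (e : R), 0 < e ->
     \forall y \near x, forall v, `|'d Phi y v - 'd Phi x v| <= e * `|v|).

(* By the Riesz representation theorem such a [grad] exists and is unique when
   [Phi] is differentiable and [H] is complete. *)
Definition is_gradient (R : realType) (H : normedModType R)
    (ip : {dot H for @idfun R}) (Phi : H -> R) (grad : H -> H) : Prop :=
  forall x v, 'd Phi x v = ip (grad x) v.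

Definition strongly_convex (R : realType) (H : normedModType R)
    (ip : {dot H for @idfun R}) (mu : R) (Phi : H -> R) (grad : H -> H) : Prop :=
  forall x y,
    Phi x + ip (grad x) (y - x) + mu / 2 * `|y - x| ^+ 2 <= Phi y.

Definition argmin (R : realType) (H : Type) (Phi : H -> R) : set H :=
  [set z | forall y, Phi z <= Phi y].

(* Main.v *)
Require Import Defs.
From HB Require Import structures.
From mathcomp Require Import all_boot all_order all_algebra.
From mathcomp Require Import sesquilinear.
From mathcomp Require Import all_classical all_reals all_analysis.
From mathcomp Require Import ring lra.

Set Implicit Arguments.
Unset Strict Implicit.
Unset Printing Implicit Defensive.
Import Order.TTheory GRing.Theory Num.Theory.
Import numFieldNormedType.Exports.
Local Open Scope classical_set_scope.
Local Open Scope ring_scope.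

(** The three profiles are treated at once, through what they share: on [0, +oo[
    the profile [S] starts from 0, its derivative [S'] is positive, tends to
    [kappa] at 0 and satisfies [2 S' + S^2 <= 1], and [1 - S] has a bounded
    antiderivative [G] ([damping_profile]).

    These facts already give all the limits. [S] increases and stays below 1, so
    [r (1 - S r)] is at most the integral of [1 - S] over [0, r], hence at most a
    constant [M]. Therefore [1 - S r <= M / r], and [2 S' <= 1 - S^2 <= 2 (1 - S)]
    transfers this decay to [S']. The limits of the damping coefficient follow:
    as [mu] tends to 0 through the difference quotient [S r / r] at 0, and as [t]
    tends to infinity through the limits of [S] and [S'].

    For the trajectories, put [w = (x - z) + theta x'] and
    [E = theta^2 (Phi x - Phi z) + |w|^2 / 2]. The coefficient
    [(1 + theta') / theta + mu theta] is exactly the one for which the equation of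
    motion becomes [w' = - mu theta^2 x' - theta grad Phi x]: in [E'] the terms in
    [<grad Phi x, x'>] then cancel. Strong convexity bounds the remaining
    [- theta <grad Phi x, x - z>], and [2 S' + S^2 <= 1], read as
    [1 - 2 theta' >= mu theta^2], yields [E' <= - mu theta E]
    ([energy_dissipation]). The integrating factor [weight] of this inequality is
    [expR (s t - G (s t))] with [s = Num.sqrt mu], because the derivative of
    [r - G r] is [S r]; as [G] is bounded above, it is at least a positive constant times
    [expR (s t)]. Since [theta] stays above [theta t0], this gives
    [Phi x - Phi z = O(expR (- s t))] ([trajectory_decay]). For fixed [mu] the
    exponential is the smaller of the two rates up to a constant
    ([exp_le_min]), which is the announced bound. *)

(** * One-sided and two-sided derivatives *)

Lemma dnbhs_right_cvg_within (R : realType) (a t : R) : a <= t ->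
  (0 : R)^'+ `=>` within [set h | a <= t + h] (0 : R)^'.
Proof.
move=> at_ A /= [e /= e0 He]; exists e => //= h he h0; apply: (He h he).
  by rewrite gt_eqF.
by rewrite /= (le_trans at_) // lerDl ltW.
Qed.

Lemma within_proper (R : realType) (a t : R) : a <= t ->
  ProperFilter (within [set h | a <= t + h] (0 : R)^').
Proof.
move=> at_; apply: Build_ProperFilter => H.
by have /filter_not_empty := dnbhs_right_cvg_within at_ H.
Qed.

Lemma within_interior (R : realType) (a t : R) : a < t ->
  within [set h | a <= t + h] (0 : R)^' = (0 : R)^'.
Proof.
move=> at_; apply/seteqP; split => A; rewrite /within /=.
  move=> H; have G : \forall h \near (0:R)^', a <= t + h.
    near=> h; have : `|h| < t - a.
      by near: h; apply: dnbhs0_lt; rewrite subr_gt0.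
    by rewrite ltr_norml opprB => /andP[h1 _]; rewrite addrC -lerBlDr ltW.
  by move: H G; apply: filterS2 => h; exact.
by move=> H; move: (H); apply: filterS => h ? ?.
Unshelve. all: by end_near. Qed.

(** The derivative writes the increment in the direction 1 as [h *: 1 + t]. *)
Lemma quotient_shift (R : realType) (V : normedModType R) (f : R -> V) (t : R) :
  (fun h => h^-1 *: ((f \o shift t) (h *: (1 : R)) - f t)) =
  (fun h => h^-1 *: (f (t + h) - f t)).
Proof. by apply/funext => h /=; rewrite [h%:A]mulr1 (addrC h). Qed.

Lemma is_derive_quotient (R : realType) (V : normedModType R) (a t : R)
    (f : R -> V) (d : V) : is_derive t 1 f d -> quotient_from a f t --> d.
Proof.
move=> [df <-]; rewrite /derivable quotient_shift in df.
apply: cvg_within_filter; rewrite /derive quotient_shift; exact: df.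
Qed.

Lemma is_derive_derivable_from (R : realType) (V : normedModType R) (a t : R)
    (f : R -> V) (d : V) : is_derive t 1 f d -> derivable_from a f t.
Proof. by move=> /(@is_derive_quotient _ _ a) H; apply/cvg_ex; exists d. Qed.

Lemma is_derive_derive_from (R : realType) (V : normedModType R) (a t : R)
    (f : R -> V) (d : V) : a <= t -> is_derive t 1 f d -> derive_from a f t = d.
Proof.
move=> /within_proper ? /(@is_derive_quotient _ _ a); exact: cvg_lim.
Qed.

Lemma derivable_from_is_derive (R : realType) (V : normedModType R) (a t : R)
    (f : R -> V) : a < t -> derivable_from a f t ->
  is_derive t 1 f (derive_from a f t).
Proof.
rewrite /derivable_from /derive_from /quotient_from => at_.
rewrite within_interior // -quotient_shift => df; exact: DeriveDef.
Qed.

(** This supplies the continuity at the initial time, where trajectories have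
    only one-sided derivatives; after it the two-sided calculus applies. *)
Lemma derivable_from_cvg_right (R : realType) (V : normedModType R) (a : R)
    (f : R -> V) : derivable_from a f a -> f t @[t --> a^'+] --> f a.
Proof.
move=> df.
have sh : t - a @[t --> a^'+] --> (0 : R)^'+.
  move=> A /= [e /= e0 He]; exists e => //= t te at_; apply: He.
    by rewrite /= sub0r opprB -normrN opprB distrC.
  by rewrite /= subr_gt0.
have q : (t - a)^-1 *: (f (a + (t - a)) - f a) @[t --> a^'+] -->
    derive_from a f a.
  have q0 : h^-1 *: (f (a + h) - f a) @[h --> 0^'+] --> derive_from a f a.
    exact: (cvg_trans (cvg_app _ (dnbhs_right_cvg_within (lexx a))) df).
  exact: (cvg_comp _ _ sh q0).
have r : t - a @[t --> a^'+] --> (0 : R)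
  by apply: (cvg_trans sh); exact: cvg_within.
have : f a + (t - a) *: ((t - a)^-1 *: (f (a + (t - a)) - f a))
    @[t --> a^'+] --> f a + 0 *: derive_from a f a.
  by apply: cvgD; [exact: cvg_cst|exact: cvgZ].
rewrite scale0r addr0; apply: cvg_trans; apply: near_eq_cvg; near=> t.
have ta : t - a != 0 by rewrite subr_eq0 gt_eqF //; near: t; exact: nbhs_right_gt.
by rewrite /= scalerA mulfV // scale1r (addrC a) subrK addrC subrK.
Unshelve. all: by end_near. Qed.

Lemma is_derive1P (R : realType) (V : normedModType R) (f : R -> V) (t : R)
    (d : V) :
  is_derive t 1 f d <-> h^-1 *: (f (t + h) - f t) @[h --> 0^'] --> d.
Proof.
split=> [[df <-]|H]; first by rewrite /derive -quotient_shift; exact: df.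
apply: DeriveDef; first by apply/cvg_ex; exists d; rewrite quotient_shift.
by rewrite /derive quotient_shift; exact: cvg_lim.
Qed.

Lemma is_derive_cvg (R : realType) (V : normedModType R) (f : R -> V) (t : R)
    (d : V) : is_derive t 1 f d -> f s @[s --> t] --> f t.
Proof. by move=> [/derivable1_diffP/differentiable_continuous ? _]. Qed.

Lemma is_derive_shift_cvg (R : realType) (V : normedModType R) (f : R -> V)
    (t : R) (d : V) : is_derive t 1 f d -> f (t + h) @[h --> 0^'] --> f t.
Proof.
move=> df; have sh : t + h @[h --> (0:R)^'] --> t.
  rewrite -[X in _ --> X](addr0 t); apply: cvgD; first exact: cvg_cst.
  exact: nbhs_dnbhs.
exact: (cvg_comp _ _ sh (is_derive_cvg df)).
Qed.

Lemma is_derive_add (R : realType) (V : normedModType R) (f g : R -> V) (t : R)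
    (a b : V) : is_derive t 1 f a -> is_derive t 1 g b ->
  is_derive t 1 (fun s => f s + g s) (a + b).
Proof. by move=> df dg; exact: is_deriveD df dg. Qed.

(** The product rule for a real function times a vector-valued one; with
    [V := R] it also serves as the pointwise product rule for real functions. *)
Lemma is_derive_scale (R : realType) (V : normedModType R) (f : R -> R)
    (g : R -> V) (t a : R) (b : V) :
  is_derive t 1 f a -> is_derive t 1 g b ->
  is_derive t 1 (fun s => f s *: g s) (f t *: b + a *: g t).
Proof.
move=> df dg; apply/is_derive1P.
have -> : (fun h => h^-1 *: (f (t + h) *: g (t + h) - f t *: g t)) =
  (fun h => f (t + h) *: (h^-1 *: (g (t + h) - g t)) +
            (h^-1 *: (f (t + h) - f t)) *: g t).
  apply/funext => h; rewrite scalerA mulrC -!scalerA -scalerDr; congr (_ *: _).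
  by rewrite scalerBr scalerBl addrA subrK.
apply: cvgD; apply: cvgZ.
- exact: is_derive_shift_cvg df.
- exact/is_derive1P.
- exact/is_derive1P.
- exact: cvg_cst.
Qed.

Lemma is_derive_diff_comp (R : realType) (H : normedModType R) (Phi : H -> R)
    (x : R -> H) (t : R) (v : H) :
  differentiable Phi (x t) -> is_derive t 1 x v ->
  is_derive t 1 (Phi \o x) ('d Phi (x t) v).
Proof.
move=> dP [/derivable1_diffP dx xv].
have dPx : differentiable (Phi \o x) t by exact: differentiable_comp.
apply: DeriveDef; first exact/derivable1_diffP.
by rewrite deriveE // diff_comp //= -xv deriveE.
Qed.

(** * Calculus with an inner product *)

Lemma ipC (R : realType) (H : normedModType R) (ip : {dot H for @idfun R})
  (u v : H) : ip u v = ip v u.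
Proof. by rewrite hermC expr0 mul1r. Qed.

Lemma ipDl (R : realType) (H : normedModType R) (ip : {dot H for @idfun R})
  (u v w : H) : ip (u + v) w = ip u w + ip v w.
Proof. exact: linearDl. Qed.

Lemma ipDr (R : realType) (H : normedModType R) (ip : {dot H for @idfun R})
  (u v w : H) : ip u (v + w) = ip u v + ip u w.
Proof. exact: linearDr. Qed.

Lemma ipNl (R : realType) (H : normedModType R) (ip : {dot H for @idfun R})
  (u v : H) : ip (- u) v = - ip u v.
Proof. exact: linearNl. Qed.

Lemma ipNr (R : realType) (H : normedModType R) (ip : {dot H for @idfun R})
  (u v : H) : ip u (- v) = - ip u v.
Proof. exact: linearNr. Qed.

Lemma ipZl (R : realType) (H : normedModType R) (ip : {dot H for @idfun R})
  (a : R) (u v : H) : ip (a *: u) v = a * ip u v.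
Proof. exact: linearZl_LR. Qed.

Lemma ipZr (R : realType) (H : normedModType R) (ip : {dot H for @idfun R})
  (a : R) (u v : H) : ip u (a *: v) = a * ip u v.
Proof. exact: linearZr_LR. Qed.

(** Expressing the form through the norm makes its joint continuity, [cvg_ip], a
    consequence of the continuity of the norm. *)
Lemma polarization (R : realType) (H : normedModType R)
    (ip : {dot H for @idfun R}) : induces_norm ip ->
  forall u v, ip u v = (`|u + v| ^+ 2 - `|u - v| ^+ 2) / 4.
Proof.
move=> nE u v; rewrite !nE hnormD hnormB /= expr0 mul1r.
by field.
Qed.

Lemma cvg_ip (R : realType) (H : normedModType R) (ip : {dot H for @idfun R})
    (T : Type) (F : set_system T) (FF : Filter F) (f g : T -> H) (a b : H) :
  induces_norm ip -> f @ F --> a -> g @ F --> b ->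
  ip (f x) (g x) @[x --> F] --> ip a b.
Proof.
move=> nE fa gb; rewrite (polarization nE).
under eq_fun do rewrite (polarization nE).
apply: cvgM; last exact: cvg_cst.
have cvg_sqr (k : T -> H) (c : H) :
    k @ F --> c -> `|k x| ^+ 2 @[x --> F] --> `|c| ^+ 2.
  move=> kc; have kn : `|k x| @[x --> F] --> `|c| by exact: cvg_norm.
  exact: (cvg_comp _ _ kn (@exprn_continuous R 2 `|c|)).
by apply: cvgB; apply: cvg_sqr; [exact: cvgD|exact: cvgB].
Qed.

(** The difference quotient of [ip w w] is exactly
    [ip ((w (t + h) - w t) / h) (w (t + h) + w t)], by symmetry. *)
Lemma is_derive_sqr_norm (R : realType) (H : normedModType R)
    (ip : {dot H for @idfun R}) (w : R -> H) (t : R) (d : H) :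
  induces_norm ip -> is_derive t 1 w d ->
  is_derive t 1 (fun s => `|w s| ^+ 2) (2 * ip (w t) d).
Proof.
move=> nE dw; apply/is_derive1P.
have -> : (fun h => h^-1 *: (`|w (t + h)| ^+ 2 - `|w t| ^+ 2)) =
  (fun h => ip (h^-1 *: (w (t + h) - w t)) (w (t + h) + w t)).
  apply/funext => h; rewrite !nE ipZl; congr (_ * _).
  rewrite ipDl ipNl !ipDr (ipC ip (w t) (w (t + h))); ring.
have -> : 2 * ip (w t) d = ip d (w t + w t).
  by rewrite ipDr (ipC ip d) mulr_natl mulr2n.
apply: cvg_ip => //; first exact/is_derive1P.
by apply: cvgD; [exact: is_derive_shift_cvg dw|exact: cvg_cst].
Qed.

(** * Damping profiles *)

(** [G] is an antiderivative of the defect [1 - S]. Its boundedness is the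
    integrability of [1 - S], stated in the form in which the decay estimate uses
    it. *)
Record damping_profile (R : realType) (kappa M : R) (S dS G : R -> R) : Prop :=
  DampingProfile {
  profile_derive : forall r : R, 0 <= r -> is_derive r 1 S (dS r);
  profile_defect : forall r : R, 0 <= r -> is_derive r 1 G (1 - S r);
  profile0 : S 0 = 0;
  profile_slope0 : dS 0 = kappa;
  profile_slope_cvg0 : dS r @[r --> 0^'+] --> kappa;
  profile_slope_gt0 : forall r : R, 0 <= r -> 0 < dS r;
  profile_le1 : forall r : R, 0 <= r -> 2 * dS r + S r ^+ 2 <= 1;
  profile_defect_le : forall r : R, 0 <= r -> G r - G 0 <= M }.

Lemma mean_value_ge0 (R : realType) (f df : R -> R) (a b : R) :
  (forall r : R, 0 <= r -> is_derive r 1 f (df r)) -> 0 <= a -> a <= b ->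
  exists2 c, a <= c <= b & f b - f a = df c * (b - a).
Proof.
move=> fE a0 ab; have [| |c] := @MVT_segment R f df a b ab.
- move=> r; rewrite in_itv /= => /andP[ar _]; apply: fE.
  by rewrite (le_trans a0) // ltW.
- apply: derivable_within_continuous => r; rewrite in_itv /= => /andP[ar _].
  by have [] := fE r (le_trans a0 ar).
by rewrite in_itv /= => cab E; exists c.
Qed.

Section profile_consequences.
Context (R : realType) (kappa M : R) (S dS G : R -> R)
  (SP : damping_profile kappa M S dS G).

Let dSE := profile_derive SP.
Let dGE := profile_defect SP.

Lemma profile_mono r s : 0 <= r -> r <= s -> S r <= S s.
Proof.
move=> r0 rs; have [c /andP[rc _] E] := mean_value_ge0 dSE r0 rs.
rewrite -subr_ge0 E mulr_ge0 ?subr_ge0 // ltW //.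
by apply: (profile_slope_gt0 SP); exact: le_trans rc.
Qed.

Lemma profile_ge0 r : 0 <= r -> 0 <= S r.
Proof. by move=> r0; rewrite -[0](profile0 SP) profile_mono. Qed.

Lemma profile_gt0 r : 0 < r -> 0 < S r.
Proof.
move=> r0; have [c /andP[c0 _] E] := mean_value_ge0 dSE (lexx _) (ltW r0).
move: E; rewrite (profile0 SP) !subr0 => ->; rewrite mulr_gt0 //.
exact: (profile_slope_gt0 SP).
Qed.

Lemma profile_lt1 r : 0 <= r -> S r < 1.
Proof.
move=> r0; have := profile_le1 SP r0; have := profile_slope_gt0 SP r0.
by have := profile_ge0 r0; nra.
Qed.

(** [1 - S] is nonincreasing, so on [0, r] it is at least [1 - S r], while its
    integral there is [G r - G 0]. *)
Lemma profile_defect_decay r : 0 < r -> 1 - S r <= M * r^-1.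
Proof.
move=> r0; rewrite ler_pdivlMr //.
have [c /andP[c0 cr] E] := mean_value_ge0 dGE (lexx _) (ltW r0).
apply: le_trans (profile_defect_le SP (ltW r0)).
by rewrite E subr0 ler_pM2r // lerD2l lerN2 profile_mono.
Qed.

(** From [2 S' <= 1 - S^2 = (1 - S) (1 + S) <= 2 (1 - S)]. *)
Lemma profile_slope_decay r : 0 < r -> dS r <= M * r^-1.
Proof.
move=> r0; apply: le_trans (profile_defect_decay r0).
have := profile_le1 SP (ltW r0); have := profile_ge0 (ltW r0).
by have := profile_lt1 (ltW r0); nra.
Qed.

Let decay_cvg0 : M * r^-1 @[r --> +oo] --> (0 : R).
Proof.
rewrite -(mulr0 M); apply: cvgM; first exact: cvg_cst.
by apply/gtr0_cvgV0; [exact: nbhs_pinfty_gt|exact: cvg_id].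
Qed.

Lemma profile_cvg1 : S r @[r --> +oo] --> (1 : R).
Proof.
apply: (@squeeze_cvgr _ _ _ _ (fun r => 1 - M * r^-1) (cst 1)).
- near=> r; have r0 : 0 < r by near: r; exact: nbhs_pinfty_gt.
  by rewrite lerBlDl -lerBlDr profile_defect_decay //= ltW // profile_lt1 // ltW.
- rewrite -[X in _ --> X]subr0; apply: cvgB; [exact: cvg_cst|exact: decay_cvg0].
- exact: cvg_cst.
Unshelve. all: by end_near. Qed.

Lemma profile_slope_cvg : dS r @[r --> +oo] --> (0 : R).
Proof.
apply: (@squeeze_cvgr _ _ _ _ (cst 0) (fun r => M * r^-1)).
- near=> r; have r0 : 0 < r by near: r; exact: nbhs_pinfty_gt.
  by rewrite profile_slope_decay //= andbT ltW // (profile_slope_gt0 SP) // ltW.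
- exact: cvg_cst.
- exact: decay_cvg0.
Unshelve. all: by end_near. Qed.

Lemma profile_integral :
  (\int[lebesgue_measure]_(r in `[0%R, +oo[) (1 - S r)%:E < +oo)%E.
Proof.
have mG r s : 0 <= r -> r <= s -> G r <= G s.
  move=> r0 rs; have [c /andP[rc _] E] := mean_value_ge0 dGE r0 rs.
  rewrite -subr_ge0 E mulr_ge0 ?subr_ge0 // ltW // profile_lt1 //.
  exact: le_trans rc.
(* [G] is monotone only on [0, +oo[; the truncated [G0] is so everywhere. *)
pose G0 r := G (Num.max 0 r).
have [l Gl] : exists l : R, G r @[r --> +oo] --> l.
  exists (sup (range G0)).
  have ndG0 : {homo G0 : r s / r <= s}.
    move=> r s rs; apply: mG; first by rewrite le_max lexx.
    by rewrite ge_max !le_max lexx rs orbT.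
  have ubG0 : has_ubound (range G0).
    exists (M + G 0) => _ [r _ <-]; rewrite -lerBlDr.
    by apply: (profile_defect_le SP); rewrite le_max lexx.
  have := nondecreasing_cvgr ndG0 ubG0.
  apply: cvg_trans; apply: near_eq_cvg; near=> r.
  rewrite /G0; congr G; apply: max_r; near: r; exact: nbhs_pinfty_ge.
have cr (f d : R -> R) :
    (forall r : R, 0 <= r -> is_derive r 1 f (d r)) ->
    {within `[0, +oo[, continuous f}.
  move=> fE; apply: derivable_within_continuous => r.
  by rewrite in_itv /= andbT => r0; have [] := fE r r0.
rewrite (@ge0_continuous_FTC2y _ (fun r => 1 - S r) G 0 l) //.
- by rewrite -EFinB ltry.
- by move=> r r0; rewrite subr_ge0 ltW // profile_lt1.
- by move=> r; apply: cvgB; [exact: cvg_cst|exact: (cr S dS dSE)].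
- by move=> r r0; have [] := dGE (ltW r0).
- by have /continuous_within_itvcyP[] := cr G _ dGE.
- move=> r; rewrite in_itv /= andbT => r0; rewrite derive1E.
  by apply: derive_val; exact: dGE (ltW r0).
Unshelve. all: by end_near. Qed.

(** The difference quotient of [S] at 0, since [S 0 = 0]. *)
Lemma profile_quotient_cvg0 : S r / r @[r --> 0^'+] --> kappa.
Proof.
have /is_derive1P := dSE (lexx 0); rewrite (profile_slope0 SP) => dS0.
have right0 : (0 : R)^'+ `=>` (0 : R)^'.
  move=> A [/= e e0 He]; exists e => //= h he h0; apply: (He h he).
  by rewrite gt_eqF.
have := cvg_trans (cvg_app _ right0) dS0; apply: cvg_trans.
apply: near_eq_cvg; near=> r.
by rewrite /= add0r (profile0 SP) subr0 mulrC.
Unshelve. all: by end_near. Qed.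

Lemma theta_derive (mu t : R) : 0 < mu -> 0 <= t ->
  is_derive t 1 (theta S mu) (dS (Num.sqrt mu * t)).
Proof.
move=> mu0 t0; have s0 : 0 < Num.sqrt mu by rewrite sqrtr_gt0.
have d1 : is_derive t 1 (fun u => Num.sqrt mu * u) (Num.sqrt mu).
  by apply: is_derive_eq; rewrite /GRing.scale /= mulr1.
have d2 : is_derive (Num.sqrt mu * t) 1 S (dS (Num.sqrt mu * t)).
  by apply: dSE; rewrite mulr_ge0 // ltW.
have := is_deriveZ (Num.sqrt mu)^-1 (is_derive1_comp d2 d1).
by move=> /is_derive_eq; apply; rewrite /GRing.scale /= mulrCA mulVf
  ?mulr1 // gt_eqF.
Qed.

Lemma theta_gt0 (mu t : R) : 0 < mu -> 0 < t -> 0 < theta S mu t.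
Proof.
by move=> mu0 t0; rewrite mulr_gt0 ?invr_gt0 ?profile_gt0 ?mulr_gt0 ?sqrtr_gt0.
Qed.

Lemma theta_mono (mu s t : R) : 0 < mu -> 0 <= s -> s <= t ->
  theta S mu s <= theta S mu t.
Proof.
move=> mu0 s0 st; rewrite ler_wpM2l ?invr_ge0 ?sqrtr_ge0 // profile_mono //.
  by rewrite mulr_ge0 // sqrtr_ge0.
by rewrite ler_wpM2l // sqrtr_ge0.
Qed.

Lemma deltaE (mu t : R) : 0 < mu -> 0 < t ->
  delta S mu t = (1 + dS (Num.sqrt mu * t)) / theta S mu t + mu * theta S mu t.
Proof.
move=> mu0 t0; rewrite /delta (is_derive_derive_from _ (theta_derive mu0 _)) //;
  exact: ltW.
Qed.

(** With [r = Num.sqrt mu * t], [theta S mu t] is [t * (S r / r)]: it tends to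
    [t * kappa]. *)
Lemma delta_cvg_mu (t : R) : 0 < kappa -> 0 < t ->
  delta S mu t @[mu --> 0^'+] --> (1 + 1 / kappa) / t.
Proof.
move=> k0 t0.
(* [Num.sqrt mu * t] must be seen to tend to 0 from the right, where alone [S] is
   controlled. *)
have cr : Num.sqrt mu * t @[mu --> (0:R)^'+] --> (0 : R)^'+.
  have : Num.sqrt mu * t @[mu --> (0:R)^'+] --> Num.sqrt 0 * t.
    apply: cvgM; last exact: cvg_cst.
    by apply: cvg_at_right_filter; exact: sqrt_continuous.
  rewrite sqrtr0 mul0r.
  move=> H A /= [e /= e0 He].
  have B : \forall mu \near (0:R)^'+, ball (0:R) e (Num.sqrt mu * t).
    exact: (H _ (nbhsx_ballx (0:R) e e0)).
  have C : \forall mu \near (0:R)^'+, 0 < mu by exact: nbhs_right_gt.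
  rewrite /nbhs /=; apply: filterS2 B C => mu Be mu0; apply: He => //=.
  by rewrite mulr_gt0 // sqrtr_gt0.
have dScr := cvg_comp _ _ cr (profile_slope_cvg0 SP).
have Qcr := cvg_comp _ _ cr profile_quotient_cvg0.
have muc : mu @[mu --> (0:R)^'+] --> (0 : R) by exact: cvg_within.
have -> : (1 + 1 / kappa) / t = (1 + kappa) * (t * kappa)^-1 + 0 * (t * kappa).
  by field; rewrite !gt_eqF.
have tq : t * (S (Num.sqrt mu * t) / (Num.sqrt mu * t)) @[mu --> (0:R)^'+] --> t * kappa.
  by apply: cvgM; [exact: cvg_cst|exact: Qcr].
have : (1 + dS (Num.sqrt mu * t)) * (t * (S (Num.sqrt mu * t) / (Num.sqrt mu * t)))^-1
    + mu * (t * (S (Num.sqrt mu * t) / (Num.sqrt mu * t))) @[mu --> (0:R)^'+]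
    --> (1 + kappa) * (t * kappa)^-1 + 0 * (t * kappa).
  apply: cvgD; apply: cvgM => //.
    by apply: cvgD; [exact: cvg_cst|exact: dScr].
  by apply: cvgV => //; rewrite mulf_neq0 // gt_eqF.
apply: cvg_trans; apply: near_eq_cvg; near=> mu.
have mu0 : 0 < mu by near: mu; exact: nbhs_right_gt.
have s0 : 0 < Num.sqrt mu by rewrite sqrtr_gt0.
rewrite deltaE // /theta; have -> // : t * (S (Num.sqrt mu * t) / (Num.sqrt mu * t)) =
  (Num.sqrt mu)^-1 * S (Num.sqrt mu * t).
by field; rewrite !gt_eqF.
Unshelve. all: by end_near. Qed.

Lemma delta_cvg_t (mu : R) : 0 < mu ->
  delta S mu t @[t --> +oo] --> 2 * Num.sqrt mu.
Proof.
move=> mu0; have s0 : 0 < Num.sqrt mu by rewrite sqrtr_gt0.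
have cr : Num.sqrt mu * t @[t --> +oo] --> +oo.
  by apply: gt0_cvgMry => //; exact: cvg_id.
have dScr := cvg_comp _ _ cr profile_slope_cvg.
have Scr := cvg_comp _ _ cr profile_cvg1.
have tq : theta S mu t @[t --> +oo] --> (Num.sqrt mu)^-1 * 1.
  by apply: cvgM; [exact: cvg_cst|exact: Scr].
have -> : 2 * Num.sqrt mu =
    (1 + 0) / ((Num.sqrt mu)^-1 * 1) + mu * ((Num.sqrt mu)^-1 * 1).
  rewrite -[X in X * (_ * 1)](sqr_sqrtr (ltW mu0)); field; by rewrite gt_eqF.
have : (1 + dS (Num.sqrt mu * t)) * (theta S mu t)^-1 + mu * theta S mu t
   @[t --> +oo] --> (1 + 0) / ((Num.sqrt mu)^-1 * 1) + mu * ((Num.sqrt mu)^-1 * 1).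
  apply: cvgD; apply: cvgM => //.
  - by apply: cvgD; [exact: cvg_cst|exact: dScr].
  - by apply: cvgV => //; rewrite mulr1 invr_neq0 // gt_eqF.
  - exact: cvg_cst.
apply: cvg_trans; apply: near_eq_cvg; near=> t.
by rewrite deltaE //; near: t; exact: nbhs_pinfty_gt.
Unshelve. all: by end_near. Qed.

End profile_consequences.

(** * Decay of the energy along trajectories *)

(** The differential inequality [E' <= - mu theta E] at one instant, with
    [u = x - z], [v = x'], [A = x''], [g] the gradient and [F = Phi x - Phi z].
    Once [w'] is simplified, the right-hand side exceeds the left-hand side by
    three nonnegative terms: the slack of strong convexity times [th], that of the
    profile inequality times [th * F], and [mu * th ^+ 3 / 2] times the squared
    norm of [v]. *)
Lemma energy_dissipation (R : realType) (H : normedModType R)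
    (ip : {dot H for @idfun R}) (mu th th' F : R) (u v g A : H) :
  induces_norm ip -> 0 < mu -> 0 < th -> mu * th ^+ 2 + 2 * th' <= 1 -> 0 <= F ->
  F + mu / 2 * `|u| ^+ 2 <= ip g u ->
  A + ((1 + th') / th + mu * th) *: v + g = 0 ->
  2 * th * th' * F + th ^+ 2 * ip g v + ip (u + th *: v) (v + (th *: A + th' *: v))
  <= - (mu * th) * (th ^+ 2 * F + `|u + th *: v| ^+ 2 / 2).
Proof.
move=> nE mu0 th0 h1 F0 h2 ode.
(* The choice of the damping coefficient removes [A] and the [th'] terms. *)
have -> : v + (th *: A + th' *: v) = - (mu * th ^+ 2) *: v - th *: g.
  have -> : A = - (((1 + th') / th + mu * th) *: v + g).
    by apply/eqP; rewrite -addr_eq0 addrA ode.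
  have th_neq0 : th != 0 by rewrite gt_eqF.
  have -> : - (mu * th ^+ 2) = 1 - th * ((1 + th') / th + mu * th) + th' by field.
  move: ((1 + th') / th + mu * th) => d.
  rewrite !scalerDl scaleNr scale1r scalerN scalerDr scalerA opprD.
  by rewrite [- _ - _ + _]addrAC !addrA.
rewrite (nE (u + _)) !(ipDl, ipDr, ipNr, ipZl, ipZr).
move: h2; rewrite nE (ipC ip v u) (ipC ip u g) (ipC ip v g).
have := sqr_ge0 `|v|; rewrite nE.
move: (ip u u) (ip u v) (ip v v) (ip g u) (ip g v) => a b c gu gv c0 h2.
have e1 : 0 <= th * (gu - (F + mu / 2 * a)) by rewrite mulr_ge0 ?subr_ge0 // ltW.
have e2 : 0 <= th * F * (1 - (mu * th ^+ 2 + 2 * th')).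
  by rewrite !mulr_ge0 ?subr_ge0 // ltW.
have e3 : 0 <= mu * th ^+ 3 * c by rewrite !mulr_ge0 // ?exprn_ge0 // ltW.
lra.
Qed.

Lemma nonincreasing_from (R : realType) (f df : R -> R) (a : R) :
  (forall t, a < t -> is_derive t 1 f (df t)) -> (forall t, a < t -> df t <= 0) ->
  f t @[t --> a^'+] --> f a -> forall t, a <= t -> f t <= f a.
Proof.
move=> fE df0 fa t at_; apply: (@ler0_derive1_nincry R f a) => //.
- by move=> r; rewrite in_itv /= andbT => ar; have [] := fE r ar.
- move=> r; rewrite in_itv /= andbT => ar.
  by rewrite derive1E; have [_ ->] := fE r ar; exact: df0.
- apply/continuous_within_itvcyP; split => // r; rewrite in_itv /= andbT => ar.
  exact: is_derive_cvg (fE r ar).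
Qed.

(** An integrating factor: its logarithmic derivative at [t] is
    [mu * theta S mu t]. *)
Definition weight (R : realType) (G : R -> R) (mu t : R) : R :=
  expR (Num.sqrt mu * t - G (Num.sqrt mu * t)).

Definition energy (R : realType) (H : normedModType R) (S : R -> R) (mu : R)
    (Phi : H -> R) (z : H) (x v : R -> H) (t : R) : R :=
  theta S mu t ^+ 2 * (Phi (x t) - Phi z) +
  `|(x t - z) + theta S mu t *: v t| ^+ 2 / 2.

Lemma weight_derive (R : realType) (kappa M : R) (S dS G : R -> R)
    (SP : damping_profile kappa M S dS G) (mu t : R) : 0 < mu -> 0 <= t ->
  is_derive t 1 (weight G mu) (mu * theta S mu t * weight G mu t).
Proof.
move=> mu0 t0; have s0 : 0 < Num.sqrt mu by rewrite sqrtr_gt0.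
have d1 : is_derive t 1 (fun u => Num.sqrt mu * u) (Num.sqrt mu).
  by apply: is_derive_eq; rewrite /GRing.scale /= mulr1.
have d2 : is_derive (Num.sqrt mu * t) 1 (fun r => r - G r) (S (Num.sqrt mu * t)).
  have dG : is_derive (Num.sqrt mu * t) 1 G (1 - S (Num.sqrt mu * t)).
    by apply: (profile_defect SP); rewrite mulr_ge0 // ltW.
  by apply: is_derive_eq; rewrite opprB addrC subrK.
have d3 := is_derive1_comp (is_derive_expR _) (is_derive1_comp d2 d1).
apply: (is_derive_eq d3); rewrite /weight /theta /=.
have muE : mu = Num.sqrt mu ^+ 2 by rewrite sqr_sqrtr // ltW.
move: (expR _) (S _) => a b; rewrite [X in _ = X * _ * _]muE.
by field; rewrite gt_eqF.
Qed.

Lemma energy_derive (R : realType) (kappa M : R) (S dS G : R -> R)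
    (SP : damping_profile kappa M S dS G) (H : normedModType R)
    (ip : {dot H for @idfun R}) (mu t : R) (Phi : H -> R) (z A : H)
    (x v : R -> H) :
  induces_norm ip -> 0 < mu -> 0 <= t -> differentiable Phi (x t) ->
  is_derive t 1 x (v t) -> is_derive t 1 v A ->
  let th := theta S mu t in let th' := dS (Num.sqrt mu * t) in
  is_derive t 1 (energy S mu Phi z x v)
    (2 * th * th' * (Phi (x t) - Phi z) + th ^+ 2 * 'd Phi (x t) (v t) +
     ip ((x t - z) + th *: v t) (v t + (th *: A + th' *: v t))).
Proof.
move=> nE mu0 t0 dPhi dx dv th th'.
have dth : is_derive t 1 (theta S mu) th' by exact: (theta_derive SP).
have dF : is_derive t 1 (fun s => Phi (x s) - Phi z) ('d Phi (x t) (v t)).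
  have := is_derive_add (is_derive_diff_comp dPhi dx) (is_derive_cst (- Phi z) t 1).
  by rewrite addr0.
have dw : is_derive t 1 (fun s => (x s - z) + theta S mu s *: v s)
    (v t + (th *: A + th' *: v t)).
  apply: is_derive_add; last exact: is_derive_scale.
  by have := is_derive_add dx (is_derive_cst (- z) t 1); rewrite addr0.
have d2 := is_derive_scale (is_derive_scale dth dth) dF.
have d3 := is_derive_scale (is_derive_cst (2^-1 : R) t 1) (is_derive_sqr_norm nE dw).
have -> : energy S mu Phi z x v = (fun s =>
   (theta S mu s *: theta S mu s) *: (Phi (x s) - Phi z) +
   2^-1 *: `|(x s - z) + theta S mu s *: v s| ^+ 2).
  by apply/funext => s; rewrite /energy expr2 (mulrC _ 2^-1).
apply: is_derive_eq (is_derive_add d2 d3) _.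
rewrite -/th scale0r addr0 /GRing.scale /=; set q := ip _ _.
by field.
Qed.

Lemma energy_cvg_right (R : realType) (H : normedModType R) (S : R -> R)
    (mu t0 : R) (Phi : H -> R) (z : H) (x v : R -> H) :
  theta S mu t @[t --> t0^'+] --> theta S mu t0 ->
  differentiable Phi (x t0) ->
  x t @[t --> t0^'+] --> x t0 -> v t @[t --> t0^'+] --> v t0 ->
  energy S mu Phi z x v t @[t --> t0^'+] --> energy S mu Phi z x v t0.
Proof.
move=> cth dPhi cx cv.
have sqr (f : R -> R) : f t @[t --> t0^'+] --> f t0 ->
    f t ^+ 2 @[t --> t0^'+] --> f t0 ^+ 2.
  by move=> cf; exact: (cvg_comp _ _ cf (@exprn_continuous R 2 (f t0))).
apply: cvgD; apply: cvgM.
- exact: sqr.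
- apply: cvgB; last exact: cvg_cst.
  exact: (cvg_comp _ _ cx (differentiable_continuous dPhi)).
- apply: (sqr (fun t => `|(x t - z) + theta S mu t *: v t|)); apply: cvg_norm.
  by apply: cvgD; [apply: cvgB => //; exact: cvg_cst|exact: cvgZ].
- exact: cvg_cst.
Qed.

(** From [expR y >= 1 + y] at [y = Num.sqrt mu * t / 2], squared:
    [t ^+ 2 * expR (- (Num.sqrt mu * t)) <= 4 / mu]. *)
Lemma exp_le_min (R : realType) (mu t : R) : 0 < mu -> 0 < t ->
  expR (- (Num.sqrt mu * t)) <=
  (1 + 4 / mu) * Num.min (1 / t ^+ 2) (expR (- (Num.sqrt mu * t))).
Proof.
move=> mu0 t0; have s0 : 0 < Num.sqrt mu by rewrite sqrtr_gt0.
have e0 := expR_gt0 (- (Num.sqrt mu * t)).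
have m0 : 0 < 4 / mu by rewrite divr_gt0.
have c0 : 0 <= 1 + 4 / mu by rewrite addr_ge0 // ltW.
rewrite minr_pMr // le_min; apply/andP; split; last first.
  by apply: ler_peMl; rewrite ?lerDl ltW.
rewrite mulrA ler_pdivlMr ?exprn_gt0 // mulr1.
apply: (@le_trans _ _ (4 / mu)); last by rewrite lerDr.
rewrite expRN mulrC ler_pdivrMr ?expR_gt0 // mulrAC ler_pdivlMr //.
set s := Num.sqrt mu in s0 *.
have -> : s * t = s * t / 2 + s * t / 2 by field.
rewrite expRD -(sqr_sqrtr (ltW mu0)) -/s.
have h : s * t / 2 <= expR (s * t / 2).
  by apply: le_trans (expR_ge1Dx _); rewrite lerDr.
have := @ler_pM _ _ _ _ _ _ _ h h.
have p : 0 <= s * t / 2 by rewrite !mulr_ge0 // ltW.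
move=> /(_ p p); lra.
Qed.

(** [weight * energy] is nonincreasing; it remains to bound [weight] below by a
    multiple of [expR (Num.sqrt mu * t)] and [energy] below by a multiple of
    [Phi (x t) - Phi z]. *)
Lemma trajectory_decay (R : realType) (kappa M : R) (S dS G : R -> R)
    (SP : damping_profile kappa M S dS G) (mu t0 : R) (H : normedModType R)
    (ip : {dot H for @idfun R}) (Phi : H -> R) (grad : H -> H) (z : H)
    (x : R -> H) :
  0 < mu -> 0 < t0 -> induces_norm ip -> (forall y, differentiable Phi y) ->
  is_gradient ip Phi grad -> strongly_convex ip mu Phi grad -> argmin Phi z ->
  C2_from t0 x ->
  (forall t, t0 <= t ->
     derive_from t0 (derive_from t0 x) t
     + delta S mu t *: derive_from t0 x t + grad (x t) = 0) ->
  exists C : R, forall t, t0 <= t ->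
    Phi (x t) - Phi z <= C * expR (- (Num.sqrt mu * t)).
Proof.
move=> mu0 t00 nE dPhi gE sc zmin [dx dv _] ode.
set v := derive_from t0 x in dv ode *.
set E := energy S mu Phi z x v.
have F0 t : 0 <= Phi (x t) - Phi z by rewrite subr_ge0; exact: zmin.
have tpos t : t0 <= t -> 0 < t by exact: lt_le_trans.
have decay t : t0 <= t -> weight G mu t * E t <= weight G mu t0 * E t0.
  move: t; apply: (nonincreasing_from (f := fun t => weight G mu t * E t)
    (df := fun t => weight G mu t *
      (2 * theta S mu t * dS (Num.sqrt mu * t) * (Phi (x t) - Phi z)
       + theta S mu t ^+ 2 * 'd Phi (x t) (v t)
       + ip ((x t - z) + theta S mu t *: v t)
          (v t + (theta S mu t *: derive_from t0 v t
                  + dS (Num.sqrt mu * t) *: v t)))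
      + mu * theta S mu t * weight G mu t * E t)).
  - move=> t tt; have t_ge0 := ltW (tpos _ (ltW tt)).
    apply: (is_derive_scale (V := R) (weight_derive SP mu0 t_ge0)).
    apply: (energy_derive SP) => //.
    + exact: derivable_from_is_derive tt (dx _ (ltW tt)).
    + exact: derivable_from_is_derive tt (dv _ (ltW tt)).
  - move=> t tt; have t_gt0 := tpos _ (ltW tt).
    have s0 : 0 <= Num.sqrt mu * t by rewrite mulr_ge0 ?sqrtr_ge0 // ltW.
    rewrite /= (mulrAC _ (weight G mu t)) (mulrC _ (weight G mu t)) -mulrDr.
    rewrite pmulr_rle0 ?expR_gt0 // -lerBrDr sub0r -mulNr gE.
    apply: (@energy_dissipation _ _ _ _ _ _ _ _ _ (grad (x t))) => //.
    + exact: (theta_gt0 SP).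
    + have := profile_le1 SP s0; congr (_ <= _); rewrite addrC /theta exprMn exprVn.
      by rewrite (sqr_sqrtr (ltW mu0)) mulrA mulfV ?mul1r // gt_eqF.
    + have := sc (x t) z; rewrite -(opprB (x t) z) normrN ipNr; lra.
    + by rewrite -(deltaE SP) // ode // ltW.
  - apply: cvgM.
      apply: cvg_at_right_filter; exact: is_derive_cvg (weight_derive SP mu0 (ltW t00)).
    apply: energy_cvg_right => //.
    + apply: cvg_at_right_filter.
      exact: is_derive_cvg (theta_derive SP mu0 (ltW t00)).
    + exact: derivable_from_cvg_right (dx _ (lexx _)).
    + exact: derivable_from_cvg_right (dv _ (lexx _)).
pose th0 := theta S mu t0; have th00 : 0 < th0 by exact: (theta_gt0 SP).
exists (weight G mu t0 * E t0 * expR (M + G 0) / th0 ^+ 2) => t tt.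
have t_gt0 := tpos _ tt.
have thle : th0 <= theta S mu t by apply: (theta_mono SP); rewrite // ltW.
(* In the energy, [theta] only grows with time and the squared norm is dropped. *)
have FE : th0 ^+ 2 * (Phi (x t) - Phi z) <= E t.
  rewrite /E /energy (@le_trans _ _ (theta S mu t ^+ 2 * (Phi (x t) - Phi z))) //.
    by rewrite ler_wpM2r // ler_sqr ?nnegrE // ltW // (theta_gt0 SP).
  by rewrite lerDl divr_ge0 ?sqr_ge0.
have wge : expR (Num.sqrt mu * t) <= weight G mu t * expR (M + G 0).
  rewrite /weight -expRD ler_expR -addrA lerDl addrC subr_ge0 -lerBlDr.
  by apply: (profile_defect_le SP); rewrite mulr_ge0 ?sqrtr_ge0 // ltW.
rewrite mulrAC ler_pdivlMr ?exprn_gt0 // expRN ler_pdivlMr ?expR_gt0 //.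
apply: (@le_trans _ _ (E t * (weight G mu t * expR (M + G 0)))).
  apply: ler_pM => //; [|by rewrite mulrC].
  by rewrite mulr_ge0 // exprn_ge0 // ltW.
rewrite mulrA (mulrC (E t)) ler_wpM2r ?expR_ge0 //; exact: decay.
Qed.

(** * The three profiles *)

(** The profile inequality when [S = 1 - u] and [S' <= kappa * u]; it amounts to
    [u <= 2 * (1 - kappa)], which holds because [kappa <= 1 / 2]. *)
Lemma defect_slope_bound (R : realType) (kappa u : R) :
  kappa <= 1 / 2 -> 0 <= u -> u <= 1 ->
  2 * (kappa * u) + (1 - u) ^+ 2 <= 1.
Proof. by move=> k1 u0 u1; nra. Qed.

Lemma S_exp_profile (R : realType) (kappa : R) : 0 < kappa -> kappa <= 1 / 2 ->
  damping_profile kappa kappa^-1 (S_exp kappa)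
    (fun r => kappa * expR (- (kappa * r)))
    (fun r => - (kappa^-1 * expR (- (kappa * r)))).
Proof.
move=> k0 k1.
have de (r : R) : is_derive r 1 (fun s => expR (- (kappa * s)))
    (- (kappa * expR (- (kappa * r)))).
  have dl : is_derive r 1 (fun s => - (kappa * s)) (- kappa).
    by apply: is_derive_eq; rewrite /= /GRing.scale /= mulr1.
  by apply: is_derive_eq (is_derive1_comp (is_derive_expR _) dl) _; rewrite mulrN mulrC.
have le1 (r : R) : 0 <= r -> expR (- (kappa * r)) <= 1.
  by move=> r0; rewrite -expR0 ler_expR oppr_le0 mulr_ge0 // ltW.
split.
- move=> r _; have := is_derive_add (is_derive_cst (1 : R) r 1) (is_deriveN (de r)).
  by rewrite opprK add0r.
- move=> r _; apply: is_derive_eq (is_deriveN (is_deriveZ kappa^-1 (de r))) _.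
  by rewrite /S_exp /GRing.scale /=; field; rewrite gt_eqF.
- by rewrite /S_exp mulr0 oppr0 expR0 subrr.
- by rewrite mulr0 oppr0 expR0 mulr1.
- have := is_derive_cvg (is_deriveZ kappa (de 0)).
  rewrite /= {2}/GRing.scale /= mulr0 oppr0 expR0 mulr1.
  exact: cvg_at_right_filter.
- by move=> r _; rewrite mulr_gt0 // expR_gt0.
- move=> r r0; by apply: defect_slope_bound => //; exact: le1.
- move=> r r0; rewrite mulr0 oppr0 expR0 mulr1 opprK gerDr oppr_le0.
  by rewrite mulr_ge0 ?expR_ge0 // invr_ge0 ltW.
Qed.

(** With [q r] the square root of [1 + kappa^2 r^2], one has [S^2 = 1 - 1 / q^2]
    and [S' = kappa / q^3]: the profile inequality says [2 * kappa <= q]. The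
    antiderivative [r - q / kappa] starts at [- 1 / kappa] and stays below 0
    because [kappa * r <= q]. *)
Lemma S_alg_profile (R : realType) (kappa : R) : 0 < kappa -> kappa <= 1 / 2 ->
  damping_profile kappa kappa^-1 (S_alg kappa)
    (fun r => kappa / Num.sqrt (1 + kappa ^+ 2 * r ^+ 2) ^+ 3)
    (fun r => r - Num.sqrt (1 + kappa ^+ 2 * r ^+ 2) / kappa).
Proof.
move=> k0 k1.
pose q (r : R) : R := Num.sqrt (1 + kappa ^+ 2 * r ^+ 2).
have k_neq0 : kappa != 0 by rewrite gt_eqF.
have ge1 (r : R) : 1 <= 1 + kappa ^+ 2 * r ^+ 2.
  by rewrite lerDl mulr_ge0 // sqr_ge0.
have q2 r : q r ^+ 2 = 1 + kappa ^+ 2 * r ^+ 2.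
  by rewrite sqr_sqrtr // (le_trans ler01).
have q1 r : 1 <= q r by rewrite -sqrtr1 ler_wsqrtr.
have q_gt0 r : 0 < q r by exact: lt_le_trans ltr01 (q1 r).
have q_neq0 r : q r != 0 by rewrite gt_eqF.
have q0 : q 0 = 1 by rewrite /q expr0n /= mulr0 addr0 sqrtr1.
have dq (r : R) : is_derive r 1 q (kappa ^+ 2 * r / q r).
  have dp : is_derive r 1 (fun s : R => 1 + kappa ^+ 2 * s ^+ 2) (2 * kappa ^+ 2 * r).
    have d2 := is_deriveZ (kappa ^+ 2) (is_deriveX 2 (is_derive_id r (1 : R))).
    have d3 := is_derive_add (is_derive_cst (1 : R) r 1) d2.
    apply: (is_derive_eq d3).
    rewrite /GRing.scale /=; ring.
  have sp := is_derive1_sqrt (lt_le_trans ltr01 (ge1 r)).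
  have := @is_derive1_comp R Num.sqrt (fun s : R => 1 + kappa ^+ 2 * s ^+ 2)
    r _ _ sp dp.
  move=> /is_derive_eq; apply; rewrite -/(q r); field; exact: q_neq0.
have dS (r : R) : is_derive r 1 (S_alg kappa) (kappa / q r ^+ 3).
  have dk := is_deriveZ kappa (is_derive_id r (1 : R)).
  apply: is_derive_eq (is_derive_scale dk (is_deriveV (q_neq0 r) (dq r))) _.
  rewrite /= /GRing.scale /= mulr1.
  have -> : kappa / q r ^+ 3 = kappa * (q r ^+ 2 - kappa ^+ 2 * r ^+ 2) / q r ^+ 3.
    by rewrite q2 addrK mulr1.
  by field.
have kr_le r : 0 <= r -> kappa * r <= q r.
  move=> r0; rewrite -ler_sqr ?nnegrE ?(mulr_ge0 (ltW k0)) ?(ltW (q_gt0 r)) //.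
  by rewrite q2 exprMn lerDr.
split.
- by move=> r _; exact: dS.
- move=> r _; apply: is_derive_eq (is_derive_add (is_derive_id r (1 : R))
    (is_deriveN (is_derive_scale (dq r) (is_derive_cst (kappa^-1 : R) r 1)))) _.
  by rewrite /GRing.scale /S_alg /= -/(q r); field; rewrite k_neq0 q_neq0.
- by rewrite /S_alg mulr0 mul0r.
- by rewrite -/(q 0) q0 expr1n divr1.
- have cq0 : q r @[r --> 0^'+] --> q 0.
    by apply: cvg_at_right_filter; exact: is_derive_cvg (dq 0).
  have : kappa / q r ^+ 3 @[r --> 0^'+] --> kappa / q 0 ^+ 3.
    apply: cvgM; first exact: cvg_cst.
    apply: cvgV; first by rewrite expf_neq0.
    exact: (cvg_comp _ _ cq0 (@exprn_continuous R 3 (q 0))).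
  by rewrite q0 expr1n divr1.
- by move=> r _; rewrite divr_gt0 // exprn_gt0 // q_gt0.
- move=> r r0; rewrite /S_alg -/(q r) expr_div_n exprMn.
  have -> : kappa ^+ 2 * r ^+ 2 = q r ^+ 2 - 1 by rewrite q2 addrC addKr.
  rewrite -subr_ge0.
  have -> : 1 - (2 * (kappa / q r ^+ 3) + (q r ^+ 2 - 1) / q r ^+ 2) =
    (q r - 2 * kappa) / q r ^+ 3 by field.
  rewrite divr_ge0 // ?exprn_ge0 ?(ltW (q_gt0 r)) //; have := q1 r; lra.
- move=> r r0; rewrite -/(q r) -/(q 0) q0 sub0r opprK div1r gerDr subr_le0.
  by rewrite ler_pdivlMr // mulrC kr_le.
Qed.

(** The exponent [p > 1] makes [(1 + kappa r / p)^(1 - p)], hence the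
    antiderivative, bounded. As the base is at least 1, [S' <= kappa * (1 - S)],
    so the profile inequality is the same as for the exponential profile. *)
Lemma S_poly_profile (R : realType) (kappa p : R) :
  0 < kappa -> kappa <= 1 / 2 -> 1 < p ->
  damping_profile kappa (p / (kappa * (p - 1))) (S_poly kappa p)
    (fun r => kappa * (1 + kappa * r / p) `^ (- p - 1))
    (fun r => - (p / (kappa * (p - 1)) * (1 + kappa * r / p) `^ (1 - p))).
Proof.
move=> k0 k1 p1; have p0 : 0 < p by exact: lt_trans p1.
have p_neq0 : p != 0 by rewrite gt_eqF.
have pm_gt0 : 0 < p - 1 by rewrite subr_gt0.
pose b (r : R) : R := 1 + kappa * r / p.
have b1 r : 0 <= r -> 1 <= b r.
  by move=> r0; rewrite lerDl !mulr_ge0 ?invr_ge0 // ltW.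
have b_gt0 r : 0 <= r -> 0 < b r by move=> /b1; exact: lt_le_trans.
have b0 : b 0 = 1 by rewrite /b mulr0 mul0r addr0.
have db (r : R) : is_derive r 1 b (kappa / p).
  apply: is_derive_eq (is_derive_add (is_derive_cst (1 : R) r 1)
    (is_derive_scale (is_deriveZ kappa (is_derive_id r (1 : R)))
       (is_derive_cst (p^-1 : R) r 1))) _.
  by rewrite /GRing.scale /= mulr0 !add0r mulr1.
have dpow (a r : R) : 0 <= r ->
    is_derive r 1 (fun s => b s `^ a) (a * b r `^ (a - 1) * (kappa / p)).
  by move=> r0; exact: is_derive1_comp (is_derive1_powR a (b_gt0 r r0)) (db r).
split.
- move=> r r0; apply: is_derive_eq (is_derive_add (is_derive_cst (1 : R) r 1)
    (is_deriveN (dpow (- p) r r0))) _.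
  by rewrite -/(b r); field.
- move=> r r0; apply: is_derive_eq
    (is_deriveN (is_deriveZ (p / (kappa * (p - 1))) (dpow (1 - p) r r0))) _.
  rewrite /S_poly -/(b r) /GRing.scale /=.
  have -> : 1 - p - 1 = - p by ring.
  by field; rewrite !gt_eqF.
- by rewrite /S_poly -/(b 0) b0 powR1 subrr.
- by rewrite -/(b 0) b0 powR1 mulr1.
- have := is_derive_cvg (is_deriveZ kappa (dpow (- p - 1) 0 (lexx _))).
  rewrite /= {2}/GRing.scale /= b0 powR1 mulr1.
  exact: cvg_at_right_filter.
- by move=> r r0; rewrite mulr_gt0 // powR_gt0 // b_gt0.
- move=> r r0; rewrite /S_poly -/(b r).
  apply: (@le_trans _ _ (2 * (kappa * b r `^ (- p)) + (1 - b r `^ (- p)) ^+ 2)).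
    rewrite lerD2r !ler_pM2l // ler_powR ?b1 // gerBl //.
  apply: defect_slope_bound => //; first exact: powR_ge0.
  by rewrite -(powRr0 (b r)) ler_powR ?b1 // oppr_le0 ltW.
- move=> r r0; rewrite -/(b r) -/(b 0) b0 powR1 mulr1 opprK gerDr oppr_le0.
  by rewrite mulr_ge0 ?powR_ge0 // divr_ge0 ?mulr_ge0 // ltW.
Qed.

(** * The corollary *)

Theorem corollary2p8 (R : realType) (kappa p : R)
    (hkappa0 : 0 < kappa) (hkappa : kappa <= 1 / 2) (hp : 1 < p) :
  forall S : R -> R,
    [\/ S = S_exp kappa, S = S_alg kappa | S = S_poly kappa p] ->
  let gamma := 1 + 1 / kappa in
  (forall r, 0 <= r ->
     [/\ derivable_from 0 S r,
         0 < 2 * derive_from 0 S r + S r ^+ 2 &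
         2 * derive_from 0 S r + S r ^+ 2 <= 1]) /\
  [/\ derive_from 0 S 0 = kappa,
      S r @[r --> +oo] --> (1 : R),
      derive_from 0 S r @[r --> +oo] --> (0 : R) &
      (\int[lebesgue_measure]_(r in `[0%R, +oo[) (1 - S r)%:E < +oo)%E] /\
  [/\ 3 <= gamma,
      forall t, 0 < t -> delta S mu t @[mu --> 0^'+] --> gamma / t &
      forall mu, 0 < mu -> delta S mu t @[t --> +oo] --> 2 * Num.sqrt mu] /\
  (forall (mu t0 : R), 0 < mu -> 0 < t0 ->
   forall (H : completeNormedModType R) (ip : {dot H for @idfun R}),
     induces_norm ip ->
   forall (Phi : H -> R) (grad : H -> H),
     C1_frechet Phi -> is_gradient ip Phi grad ->
     strongly_convex ip mu Phi grad ->
   forall z : H, argmin Phi z ->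
   forall x : R -> H, C2_from t0 x ->
     (forall t, t0 <= t ->
        derive_from t0 (derive_from t0 x) t
        + delta S mu t *: derive_from t0 x t + grad (x t) = 0) ->
   exists C : R, forall t, t0 <= t ->
     `|Phi (x t) - Phi z|
       <= C * Num.min (1 / t ^+ 2) (expR (- (Num.sqrt mu * t)))).
Proof.
move=> S hS gamma.
have [M [dS [G SP]]] : exists M dS G, damping_profile kappa M S dS G.
  case: hS => ->; do 3 eexists.
  - exact: S_exp_profile.
  - exact: S_alg_profile.
  - exact: S_poly_profile.
have dE r : 0 <= r -> derive_from 0 S r = dS r.
  by move=> r0; apply: is_derive_derive_from => //; exact: (profile_derive SP).
split; [|split; [|split]].
- move=> r r0; rewrite dE //; split.
  + exact: is_derive_derivable_from (profile_derive SP r0).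
  + by rewrite ltr_wpDr ?sqr_ge0 // mulr_gt0 // (profile_slope_gt0 SP).
  + exact: (profile_le1 SP).
- split.
  + by rewrite dE // (profile_slope0 SP).
  + exact: profile_cvg1 SP.
  + apply: cvg_trans (profile_slope_cvg SP); apply: near_eq_cvg.
    by near=> r; apply/esym/dE; near: r; exact: nbhs_pinfty_ge.
  + exact: profile_integral SP.
- split.
  + have : 2 <= 1 / kappa by rewrite ler_pdivlMr //; lra.
    by rewrite /gamma; lra.
  + by move=> t t0; exact: (delta_cvg_mu SP).
  + by move=> mu mu0; exact: (delta_cvg_t SP).
- move=> mu t0 mu0 t00 H ip nE Phi grad [dPhi _] gE sc z zmin x xC2 ode.
  have [C HC] := trajectory_decay SP mu0 t00 nE dPhi gE sc zmin xC2 ode.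
  exists (C * (1 + 4 / mu)) => t tt.
  have F0 : 0 <= Phi (x t) - Phi z by rewrite subr_ge0; exact: zmin.
  have C0 : 0 <= C.
    by have := le_trans F0 (HC t tt); rewrite pmulr_lge0 // expR_gt0.
  rewrite ger0_norm // -mulrA; apply: (le_trans (HC t tt)).
  by rewrite ler_wpM2l // exp_le_min // (lt_le_trans t00).
Unshelve. all: by end_near. Qed.
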